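(* Suppose $d\ge2$. Let $\Lambda\in\mathbb{R}$ and let $\mathcal{F}:\mathcal{P}_2(\mathbb{R}^d)\to\mathbb{R}$ be a continuous $\Lambda$-geodesically convex function. If $\mathcal{F}$ is flat differentiable at $\mu\in\mathcal{P}_2(\mathbb{R}^d)$, then $\mathbb{R}^d\ni x\mapsto\mathcal{D}_\mu\mathcal{F}(\mu,x)$ is $\Lambda$-convex.
   Context: $\mathcal{P}_2(\mathbb{R}^d)$ is the space of Borel probability measures on $\mathbb{R}^d$ with finite second moment, with the $L^2$-Wasserstein distance $W_2$; continuity is with respect to $W_2$. $\mathcal{F}$ is $\Lambda$-geodesically convex if for all $\mu_0,\mu_1\in\mathcal{P}_2(\mathbb{R}^d)$ and every constant-speed $W_2$-geodesic $(\mu_t)_{t\in[0,1]}$ from $\mu_0$ to $\mu_1$, $\mathcal{F}(\mu_t)\le(1-t)\mathcal{F}(\mu_0)+t\mathcal{F}(\mu_1)-\frac{\Lambda}{2}t(1-t)W_2^2(\mu_0,\mu_1)$ for all $t\in[0,1]$. $\mathcal{F}$ is flat differentiable at $\mu$ if there is a Borel map $\mathcal{D}_\mu\mathcal{F}(\mu,\cdot):\mathbb{R}^d\to\mathbb{R}$ with at most quadratic growth such that for all $\nu\in\mathcal{P}_2(\mathbb{R}^d)$, $\lim_{h\to0^+}\frac{\mathcal{F}((1-h)\mu+h\nu)-\mathcal{F}(\mu)}{h}=\int\mathcal{D}_\mu\mathcal{F}(\mu,x)(\nu-\mu)(dx)$; it is normalized by $\int\mathcal{D}_\mu\mathcal{F}(\mu,x)d\mu(x)=0$.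 A function $f:\mathbb{R}^d\to\mathbb{R}$ is $\Lambda$-convex if $f((1-t)y_0+ty_1)\le(1-t)f(y_0)+tf(y_1)-\frac{\Lambda}{2}t(1-t)|y_0-y_1|^2$ for all $y_0,y_1$, $t\in[0,1]$. *)

(* Defs.v *)
From HB Require Import structures.
From mathcomp Require Import all_boot all_order all_algebra.
From mathcomp Require Import all_classical all_reals all_analysis.
From mathcomp Require Import measurable_realfun.

Set Implicit Arguments.
Unset Strict Implicit.
Unset Printing Implicit Defensive.

Import Order.TTheory GRing.Theory Num.Theory.
Import numFieldNormedType.Exports.
Local Open Scope classical_set_scope.
Local Open Scope ring_scope.

(* The norm `|x| of the library on row vectors is the sup norm; this is the
   Euclidean one. *)
Definition enorm (R : realType) (d : nat) (x : 'rV[R]_d) : R :=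
  Num.sqrt (\sum_(i < d) x 0 i ^+ 2).

(* R^d with its Borel sigma-algebra; the carrier is convertible to 'rV[R]_d. *)
Notation borelRV R d := (g_sigma_algebraType (@open 'rV[R]_d)).

Section wasserstein_space.
Context {R : realType} {d : nat}.

Definition second_moment (mu : probability (borelRV R d) R) : \bar R :=
  (\int[mu]_x (enorm (x : 'rV[R]_d) ^+ 2)%:E)%E.

Record P2 : Type := MkP2 {
  P2_prob :> probability (borelRV R d) R ;
  P2_second_moment : (second_moment P2_prob < +oo)%E }.

Definition coupling (mu nu : probability (borelRV R d) R)
    : set (probability (borelRV R d * borelRV R d)%type R) :=
  [set pi | forall A : set (borelRV R d), measurable A ->
    pi (A `*` setT) = mu A /\ pi (setT `*` A) = nu A].

Definition transport_cost
    (pi : probability (borelRV R d * borelRV R d)%type R) : \bar R :=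
  (\int[pi]_z (enorm ((z.1 : 'rV[R]_d) - (z.2 : 'rV[R]_d)) ^+ 2)%:E)%E.

(* On P2 the infimum is finite, so that fine loses nothing. *)
Definition W2 (mu nu : P2) : R :=
  Num.sqrt (fine (ereal_inf (transport_cost @` coupling mu nu))).

Definition W2_continuous (F : P2 -> R) : Prop :=
  forall mu : P2, forall eps : R, 0 < eps ->
    exists2 delta : R, 0 < delta &
      forall nu : P2, W2 mu nu < delta -> `|F nu - F mu| < eps.

(* A probability of the library is a function on all sets, constrained only on
   the measurable ones, so measures are compared on Borel sets. No such
   requirement is needed for functionals: W2 only sees the values on Borel sets,
   so a W2_continuous F takes the same value on measures with the same Borel
   restriction. *)
Definition eq_borel (mu nu : P2) : Prop :=
  forall A : set (borelRV R d), measurable A -> mu A = nu A.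

(* Only the values of gamma on [0, 1] matter. *)
Definition W2_geodesic (mu0 mu1 : P2) (gamma : R -> P2) : Prop :=
  [/\ eq_borel (gamma 0) mu0, eq_borel (gamma 1) mu1 &
    forall s t : R, 0 <= s <= 1 -> 0 <= t <= 1 ->
      W2 (gamma s) (gamma t) = `|s - t| * W2 mu0 mu1].

Definition geodesically_convex (Lambda : R) (F : P2 -> R) : Prop :=
  forall (mu0 mu1 : P2) (gamma : R -> P2), W2_geodesic mu0 mu1 gamma ->
    forall t : R, 0 <= t <= 1 ->
      F (gamma t) <= (1 - t) * F mu0 + t * F mu1
                     - Lambda / 2 * t * (1 - t) * W2 mu0 mu1 ^+ 2.

Definition lambda_convex (Lambda : R) (f : 'rV[R]_d -> R) : Prop :=
  forall (y0 y1 : 'rV[R]_d) (t : R), 0 <= t <= 1 ->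
    f ((1 - t) *: y0 + t *: y1) <= (1 - t) * f y0 + t * f y1
                     - Lambda / 2 * t * (1 - t) * enorm (y0 - y1) ^+ 2.

End wasserstein_space.
Arguments P2 : clear implicits.

Section mixture.
Context {R : realType} {d : nat}.

Lemma measurable_coord (i : 'I_d) :
  measurable_fun [set: borelRV R d] (fun x : borelRV R d => (x : 'rV[R]_d) 0 i).
Proof.
apply: (measurability _ (RGenOpens.measurableE R)).
move=> _ [_ [a [b ->]] <-]; rewrite setTI; apply: sub_sigma_algebra.
by apply: open_comp; [move=> x _; exact: coord_continuous|exact: interval_open].
Qed.

Lemma measurable_enorm_sqr :
  measurable_fun [set: borelRV R d]
    (fun x : borelRV R d => enorm (x : 'rV[R]_d) ^+ 2).
Proof.
have -> : (fun x : borelRV R d => enorm (x : 'rV[R]_d) ^+ 2) =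
    (fun x : borelRV R d => \sum_(i < d) (x : 'rV[R]_d) 0 i ^+ 2).
  apply/funext => x; rewrite /enorm sqr_sqrtr//.
  by apply: sumr_ge0 => i _; exact: sqr_ge0.
apply: measurable_sum => i; apply: measurable_funX; exact: measurable_coord.
Qed.

Section mixture_measure.
Variables (h : {i01 R}) (mu nu : probability (borelRV R d) R).

Definition mixture_measure : set (borelRV R d) -> \bar R :=
  measure_add (mscale (1 - h%:num)%:nng mu) (mscale h%:num%:nng nu).

HB.instance Definition _ := Measure.on mixture_measure.

Lemma mixture_measureE (A : set (borelRV R d)) :
  mixture_measure A = ((1 - h%:num)%:E * mu A + h%:num%:E * nu A)%E.
Proof. by rewrite /mixture_measure measure_addE. Qed.

Let mixture_measureT : mixture_measure setT = 1%E.
Proof.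
by rewrite mixture_measureE !probability_setT !mule1 -EFinD subrK.
Qed.

HB.instance Definition _ :=
  Measure_isProbability.Build _ _ _ mixture_measure mixture_measureT.

End mixture_measure.

Lemma mixture_second_moment (h : {i01 R}) (mu nu : P2 R d) :
  (second_moment (mixture_measure h mu nu) < +oo)%E.
Proof.
have ge0 (x : borelRV R d) : (0 <= (enorm (x : 'rV[R]_d) ^+ 2)%:E)%E.
  by rewrite lee_fin sqr_ge0.
have mf : measurable_fun [set: borelRV R d]
    (fun x : borelRV R d => (enorm (x : 'rV[R]_d) ^+ 2)%:E).
  by apply/measurable_EFinP; exact: measurable_enorm_sqr.
rewrite /second_moment ge0_integral_measure_add//.
rewrite !ge0_integral_mscale// lte_add_pinfty//.
- by rewrite lte_mul_pinfty// ?lee_fin//; exact: P2_second_moment.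
- by rewrite lte_mul_pinfty// ?lee_fin//; exact: P2_second_moment.
Qed.

Lemma clamp01_ge0 (h : R) : 0 <= Num.max 0 (Num.min h 1).
Proof. by rewrite le_max lexx. Qed.

Lemma clamp01_le1 (h : R) : Num.max 0 (Num.min h 1) <= 1.
Proof. by rewrite ge_max ler01 ge_min lexx orbT. Qed.

(* (1 - h) mu + h nu for 0 <= h <= 1; a weight h outside [0, 1] is clamped to
   the nearest endpoint so that the mixture is total in h. *)
Definition mixture (h : R) (mu nu : P2 R d) : P2 R d :=
  MkP2 (mixture_second_moment (Itv01 (clamp01_ge0 h) (clamp01_le1 h)) mu nu).

Lemma mixtureE (h : R) (mu nu : P2 R d) (A : set (borelRV R d)) :
  0 <= h <= 1 -> mixture h mu nu A = ((1 - h)%:E * mu A + h%:E * nu A)%E.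
Proof.
move=> /andP[h0 h1]; rewrite [LHS]mixture_measureE/=.
by rewrite min_l// max_r.
Qed.

End mixture.

(* Df is the normalized flat derivative of F at mu; the quadratic growth makes
   both integrals finite. *)
Definition is_flat_derivative (R : realType) (d : nat) (F : P2 R d -> R)
    (mu : P2 R d) (Df : 'rV[R]_d -> R) : Prop :=
  [/\ measurable_fun [set: borelRV R d] (Df : borelRV R d -> R),
      exists C : R, forall x : 'rV[R]_d, `|Df x| <= C * (1 + enorm x ^+ 2),
      forall nu : P2 R d,
        (F (mixture h mu nu) - F mu) / h @[h --> 0^'+] -->
          (\int[nu]_x Df x - \int[mu]_x Df x)%R &
      (\int[mu]_x Df x)%R = 0].

(* Main.v *)
(** For fixed [h], let the atom of the mixture [(1 - h) mu + h \d_y] move along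
    the segment from [y0] to [y1] while [mu] stays put. If [mu] vanishes near
    the line through [y0] and [y1], short pieces of this curve are
    [W2]-geodesics, since a short move of the atom is then an optimal transport;
    hence [F] is locally, and so globally, semiconvex along the curve. In
    dimension at least 2 there is a direction orthogonal to that line, and
    pushing [mu] off by a small amount in this direction makes it vanish near
    the line; continuity of [F] then gives semiconvexity along the curve for
    every [mu]. Subtracting [F mu], dividing by [h] and letting [h] tend to [0]
    turns the values of [F] on the mixtures into those of the flat derivative
    at points. *)
Require Import Defs.
From HB Require Import structures.
From mathcomp Require Import all_boot all_order all_algebra.
From mathcomp Require Import all_classical all_reals all_analysis.
From mathcomp Require Import measurable_realfun.
From mathcomp Require Import ring lra.

Set Implicit Arguments.
Unset Strict Implicit.
Unset Printing Implicit Defensive.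

Import Order.TTheory GRing.Theory Num.Theory.
Import numFieldNormedType.Exports.
Local Open Scope classical_set_scope.
Local Open Scope ring_scope.

(** * From local to global semiconvexity on an interval *)

Section local_convexity.
Context {R : realType}.
Implicit Types (f : R -> R) (a b l : R).

(** For [p < q < r] this compares the slopes of [f] on [[p, q]] and [[q, r]], cross-multiplied to
    avoid division. *)
Definition slope_le f p q r : Prop :=
  (f q - f p) * (r - q) <= (f r - f q) * (q - p).

Lemma slope_le_joinr f p q m r : p < q -> q < m -> m < r ->
  slope_le f p q m -> slope_le f q m r -> slope_le f p q r.
Proof.
rewrite /slope_le => pq qm mr pqm qmr.
have : (f q - f p) * (r - m) <= (f r - f m) * (q - p).
  rewrite -(ler_pM2r (_ : 0 < m - q)); last by rewrite subr_gt0.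
  have : (f q - f p) * (m - q) * (r - m) <= (f m - f q) * (q - p) * (r - m).
    by rewrite ler_wpM2r// subr_ge0 ltW.
  have : (f m - f q) * (r - m) * (q - p) <= (f r - f m) * (m - q) * (q - p).
    by rewrite ler_wpM2r// subr_ge0 ltW.
  lra.
lra.
Qed.

Lemma slope_le_joinl f p m q r : p < m -> m < q -> q < r ->
  slope_le f p m q -> slope_le f m q r -> slope_le f p q r.
Proof.
rewrite /slope_le => pm mq qr pmq mqr.
have : (f m - f p) * (r - q) <= (f r - f q) * (m - p).
  rewrite -(ler_pM2r (_ : 0 < q - m)); last by rewrite subr_gt0.
  have : (f m - f p) * (q - m) * (r - q) <= (f q - f m) * (m - p) * (r - q).
    by rewrite ler_wpM2r// subr_ge0 ltW.
  have : (f q - f m) * (r - q) * (m - p) <= (f r - f q) * (q - m) * (m - p).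
    by rewrite ler_wpM2r// subr_ge0 ltW.
  lra.
lra.
Qed.

(** Convexity on [[a, b]], tested only on triples of spread at most [l]. *)
Definition convex_windows f a b l : Prop := forall p q r,
  a <= p -> p < q -> q < r -> r <= b -> r - p <= l -> slope_le f p q r.

(* Cut the window into thirds: the points of division give windows of two
   thirds of the length, along which the slopes can be compared in turn. *)
Lemma convex_windows_grow f a b l :
  convex_windows f a b l -> convex_windows f a b (l * (3 / 2)).
Proof.
move=> H p q r ap pq qr rb rpl.
pose m := p + (r - p) / 3; pose n := p + (r - p) * (2 / 3).
have [qm|mq] := ltP q m.
  have qmn : slope_le f q m n by apply: H; rewrite /n /m in qm *; lra.
  have mnr : slope_le f m n r by apply: H; rewrite /n /m in qm *; lra.
  have pqm : slope_le f p q m by apply: H; rewrite /n /m in qm *; lra.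
  apply: (@slope_le_joinr _ _ _ m) => //; first by rewrite /m in qm *; lra.
  by apply: (@slope_le_joinr _ _ _ n) => //; rewrite /n /m in qm *; lra.
have [qn|nq] := ltP q n.
  apply: (@slope_le_joinr _ _ _ n) => //; first by rewrite /n in qn *; lra.
    by apply: H; rewrite /n /m in mq qn *; lra.
  by apply: H; rewrite /n /m in mq qn *; lra.
(* The joins need strictly ordered points, so [q = n] is separate; there a single join through [m]
   suffices. *)
have [nq'|<-] : n < q \/ n = q by case: ltgtP nq => //; [left|right].
  have mnq : slope_le f m n q by apply: H; rewrite /n /m in nq' *; lra.
  have pmn : slope_le f p m n by apply: H; rewrite /n /m in nq' *; lra.
  have nqr : slope_le f n q r by apply: H; rewrite /n /m in nq' *; lra.
  apply: (@slope_le_joinl _ _ n) => //; first by rewrite /n in nq' *; lra.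
  by apply: (@slope_le_joinl _ _ m) => //; rewrite /n /m in nq' *; lra.
apply: (@slope_le_joinl _ _ m); rewrite ?/m ?/n; [lra|lra|lra| |].
  by apply: H; lra.
by apply: H; lra.
Qed.

Lemma convex_windows_global f a b l : 0 < l ->
  convex_windows f a b l -> convex_windows f a b (b - a).
Proof.
move=> l0 H.
(* A factor [3 / 2] adds at least [l / 2] to a length that is at least [l]; this linear bound is
   enough to reach [b - a]. *)
have K (n : nat) : convex_windows f a b (l * (1 + n%:R / 2)).
  elim: n => [|n IH]; first by rewrite mul0r addr0 mulr1.
  move=> p q r ap pq qr rb rpl.
  apply: (convex_windows_grow IH) => //; apply: (le_trans rpl).
  rewrite -mulrA ler_pM2l// -natr1; have : 0 <= n%:R :> R by []; lra.
move=> p q r ap pq qr rb rpl.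
pose n := Num.truncn ((b - a) * 2 / l); apply: (K n.+1) => //.
apply: (le_trans rpl).
have : (b - a) * 2 / l < n.+1%:R.
  by rewrite truncnS_gt.
rewrite ltr_pdivrMr// => ?; lra.
Qed.

Lemma locally_semiconvex (f : R -> R) (c l : R) : 0 < l ->
  (forall p r t, 0 <= p -> p <= r -> r <= 1 -> r - p <= l -> 0 <= t <= 1 ->
    f ((1 - t) * p + t * r) <=
      (1 - t) * f p + t * f r - c * t * (1 - t) * (r - p) ^+ 2) ->
  forall t, 0 <= t <= 1 ->
    f t <= (1 - t) * f 0 + t * f 1 - c * t * (1 - t).
Proof.
move=> l0 H.
(* The square satisfies the semiconvexity relation with equality ([q2] below), so subtracting
   [c * s ^+ 2] turns semiconvexity of [f] into convexity of [g]. *)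
pose g s := f s - c * s ^+ 2.
have gl : convex_windows g 0 1 l.
  move=> p q r p0 pq qr r1 rpl.
  have rp : 0 < r - p by lra.
  pose t := (q - p) / (r - p).
  have tE : t * (r - p) = q - p by rewrite /t divfK// gt_eqF.
  have t01 : 0 <= t <= 1.
    by apply/andP; split; [rewrite divr_ge0//; lra|rewrite ler_pdivrMr//; lra].
  have qE : (1 - t) * p + t * r = q by lra.
  have := H p r t p0 (ltW (lt_trans pq qr)) r1 rpl t01; rewrite qE => K.
  rewrite /slope_le /g.
  have -> : q - p = t * (r - p) by rewrite tE.
  have -> : r - q = (1 - t) * (r - p) by rewrite mulrBl tE mul1r; lra.
  have q2 : q ^+ 2 = (1 - t) * p ^+ 2 + t * r ^+ 2 - t * (1 - t) * (r - p) ^+ 2.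
    by rewrite -[in LHS]qE; ring.
  by rewrite q2 [leLHS]mulrA [leRHS]mulrA ler_pM2r//; lra.
move=> t /andP[]; rewrite le_eqVlt => /predU1P[<- _|t0].
  by rewrite subr0 mul1r mul0r mulr0 mul0r addr0 subr0.
rewrite le_eqVlt => /predU1P[->|t1].
  by rewrite subrr mul1r mul0r mulr0 subr0 add0r.
have := convex_windows_global l0 gl (lexx 0) t0 t1 (lexx 1) (lexx _).
rewrite /slope_le /g; lra.
Qed.

End local_convexity.

(** * Euclidean geometry of row vectors *)

Section euclidean.
Context {R : realType} {d : nat}.
Implicit Types (x y v : 'rV[R]_d).

Definition dotp x y : R := \sum_(i < d) x 0 i * y 0 i.

Lemma enorm_sqrE x : enorm x ^+ 2 = \sum_(i < d) x 0 i ^+ 2.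
Proof. by rewrite sqr_sqrtr// sumr_ge0// => i _; exact: sqr_ge0. Qed.

Lemma dotpDl x y v : dotp (x + y) v = dotp x v + dotp y v.
Proof. by rewrite -big_split; apply: eq_bigr => i _; rewrite !mxE mulrDl. Qed.

Lemma dotpZl a x v : dotp (a *: x) v = a * dotp x v.
Proof. by rewrite mulr_sumr; apply: eq_bigr => i _; rewrite !mxE mulrA. Qed.

Lemma dotpNl x v : dotp (- x) v = - dotp x v.
Proof. by rewrite -scaleN1r dotpZl mulN1r. Qed.

Lemma dotpp x : dotp x x = enorm x ^+ 2.
Proof. by rewrite enorm_sqrE; apply: eq_bigr => i _; rewrite expr2. Qed.

Lemma enorm_sqrZ a x : enorm (a *: x) ^+ 2 = a ^+ 2 * enorm x ^+ 2.
Proof.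
by rewrite !enorm_sqrE mulr_sumr; apply: eq_bigr => i _; rewrite !mxE exprMn.
Qed.

Lemma enorm_sqr_add x y :
  enorm (x + y) ^+ 2 = enorm x ^+ 2 + 2 * dotp x y + enorm y ^+ 2.
Proof.
rewrite !enorm_sqrE /dotp mulr_sumr -!big_split.
by apply: eq_bigr => i _; rewrite !mxE/=; ring.
Qed.

Lemma enorm_distC x y : enorm (x - y) = enorm (y - x).
Proof.
by rewrite /enorm; congr Num.sqrt; apply: eq_bigr => i _; rewrite !mxE; ring.
Qed.

Lemma enorm_sqrD_le x y :
  enorm (x + y) ^+ 2 <= 2 * enorm x ^+ 2 + 2 * enorm y ^+ 2.
Proof.
rewrite !enorm_sqrE !mulr_sumr -big_split; apply: ler_sum => i _ /=.
by rewrite !mxE; have := sqr_ge0 (x 0 i - y 0 i); lra.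
Qed.

Lemma enorm_sqr_gt0 x i : x 0 i != 0 -> 0 < enorm x ^+ 2.
Proof.
move=> xi; rewrite enorm_sqrE (bigD1 i)//= ltr_pwDl//.
  by rewrite exprn_even_gt0.
by rewrite sumr_ge0// => j _; exact: sqr_ge0.
Qed.

Lemma dotp_delta x i : dotp x (delta_mx 0 i) = x 0 i.
Proof.
rewrite /dotp (bigD1 i)//= mxE !eqxx mulr1 big1 ?addr0// => j ji.
by rewrite mxE (negbTE ji) andbF mulr0.
Qed.

(** Two coordinates suffice: if the first one of [x] vanishes, take the first basis vector;
    otherwise turn the first two coordinates by a right angle. This is where the dimension
    enters. *)
Lemma orthogonal_exists x : (2 <= d)%N ->
  exists2 v, 0 < enorm v ^+ 2 & dotp x v = 0.
Proof.
move=> d2; pose i0 := Ordinal (ltnW d2); pose i1 := Ordinal d2.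
have [x0|x0] := eqVneq (x 0 i0) 0.
  exists (delta_mx 0 i0); last by rewrite dotp_delta.
  by apply: (@enorm_sqr_gt0 _ i0); rewrite mxE !eqxx oner_neq0.
exists (x 0 i1 *: delta_mx 0 i0 - x 0 i0 *: delta_mx 0 i1).
  apply: (@enorm_sqr_gt0 _ i1).
  by rewrite !mxE !eqxx/= mulr0 mulr1 add0r oppr_eq0.
have dotpC y w : dotp y w = dotp w y.
  by apply: eq_bigr => i _; rewrite mulrC.
rewrite dotpC dotpDl dotpNl !dotpZl ![dotp (delta_mx _ _) _]dotpC.
by rewrite !dotp_delta; ring.
Qed.

(* Cauchy-Schwarz, in the form [0 <= enorm (x -+ e *: v) ^+ 2]. *)
Lemma enorm_sqr_ge_slab x v e : 0 <= e -> e * enorm v ^+ 2 <= `|dotp x v| ->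
  e ^+ 2 * enorm v ^+ 2 <= enorm x ^+ 2.
Proof.
move=> e0 xv.
have K a : - (2 * a * dotp x v) - a ^+ 2 * enorm v ^+ 2 <= enorm x ^+ 2.
  have := sqr_ge0 (enorm (x + a *: v)).
  rewrite enorm_sqr_add enorm_sqrZ.
  have -> : dotp x (a *: v) = a * dotp x v.
    by rewrite mulr_sumr; apply: eq_bigr => i _; rewrite mxE mulrCA.
  lra.
have [xv0|xv0] := leP 0 (dotp x v).
  rewrite (ger0_norm xv0) in xv; have := ler_wpM2l e0 xv.
  by have := K (- e); rewrite sqrrN expr2; lra.
rewrite (ltr0_norm xv0) in xv; have := ler_wpM2l e0 xv.
by have := K e; rewrite expr2; lra.
Qed.

Lemma segment_sub (a b : 'rV[R]_d) (s t : R) :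
  ((1 - s) *: a + s *: b) - ((1 - t) *: a + t *: b) = (s - t) *: (b - a).
Proof. by apply/rowP => i; rewrite !mxE; ring. Qed.

End euclidean.

(** * Mixtures of probabilities on an arbitrary space *)

Section mix.
Context d (T : measurableType d) (R : realType).
Variables (h : {i01 R}) (P Q : probability T R).

(** The construction of [mixture_measure] is repeated in general because transport plans, which live
    on the product space, are mixed as well. *)
Definition mix : set T -> \bar R :=
  measure_add (mscale (1 - h%:num)%:nng P) (mscale h%:num%:nng Q).

HB.instance Definition _ := Measure.on mix.

Lemma mixE (A : set T) :
  mix A = ((1 - h%:num)%:E * P A + h%:num%:E * Q A)%E.
Proof. by rewrite /mix measure_addE. Qed.

Let mixT : mix setT = 1%E.
Proof. by rewrite mixE !probability_setT !mule1 -EFinD subrK. Qed.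

HB.instance Definition _ := Measure_isProbability.Build _ _ _ mix mixT.

Lemma ge0_integral_mix (f : T -> \bar R) :
  (forall x, 0 <= f x)%E -> measurable_fun setT f ->
  (\int[mix]_x f x =
   (1 - h%:num)%:E * \int[P]_x f x + h%:num%:E * \int[Q]_x f x)%E.
Proof.
by move=> f0 mf; rewrite ge0_integral_measure_add// !ge0_integral_mscale.
Qed.

End mix.

(** * Couplings and Wasserstein distances between mixtures with an atom *)

Section wasserstein.
Context {R : realType} {d : nat}.
Local Notation T := (borelRV R d).
Implicit Types (mu nu : P2 R d) (a b : 'rV[R]_d).

Lemma continuous_measurable_rV (f : 'rV[R]_d -> 'rV[R]_d) :
  continuous f -> measurable_fun [set: T] (f : T -> T).
Proof.
move=> cf; apply: (@measurability _ _ T T setT f open erefl).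
move=> _ [U oU <-]; rewrite setTI; apply: sub_sigma_algebra.
by apply: open_comp => // x _; exact: cf.
Qed.

Lemma measurable_point (a : T) : measurable [set a].
Proof.
rewrite -[X in measurable X]setCK; apply: measurableC; apply: sub_sigma_algebra.
by rewrite openC; apply: accessible_closed_set1; apply: hausdorff_accessible.
Qed.

Definition cost (z : T * T) : R :=
  enorm ((z.1 : 'rV[R]_d) - (z.2 : 'rV[R]_d)) ^+ 2.

Lemma measurable_cost : measurable_fun setT cost.
Proof.
have -> : cost = fun z : T * T =>
    \sum_(i < d) ((z.1 : 'rV[R]_d) 0 i - (z.2 : 'rV[R]_d) 0 i) ^+ 2.
  apply/funext => z; rewrite /cost enorm_sqrE.
  by apply: eq_bigr => i _; rewrite !mxE.
apply: measurable_sum => i; apply: measurable_funX; apply: measurable_funB.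
  exact: (measurableT_comp (measurable_coord i) measurable_fst).
exact: (measurableT_comp (measurable_coord i) measurable_snd).
Qed.

Lemma cost_ge0 z : (0 <= (cost z)%:E)%E.
Proof. by rewrite lee_fin sqr_ge0. Qed.

Lemma measurable_ecost : measurable_fun setT (fun z => (cost z)%:E).
Proof. by apply/measurable_EFinP; exact: measurable_cost. Qed.

Lemma transport_cost_ge0 pi : (0 <= @transport_cost R d pi)%E.
Proof. by apply: integral_ge0 => z _; exact: cost_ge0. Qed.

Lemma inf_transport_cost_ge0 mu nu :
  (0 <= ereal_inf (transport_cost @` coupling mu nu))%E.
Proof.
by apply: le_ereal_inf_tmp => _ [pi _ <-]; exact: transport_cost_ge0.
Qed.

Lemma W2_sqrE mu nu :
  W2 mu nu ^+ 2 = fine (ereal_inf (transport_cost @` coupling mu nu)).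
Proof. by rewrite /W2 sqr_sqrtr// fine_ge0// inf_transport_cost_ge0. Qed.

(** The coupling at hand makes the infimum finite, so that [fine] preserves it. *)
Lemma W2_sqr_le mu nu pi (c : R) : coupling mu nu pi ->
  (transport_cost pi <= c%:E)%E -> W2 mu nu ^+ 2 <= c.
Proof.
move=> cpi pic; rewrite W2_sqrE -lee_fin.
have infc : (ereal_inf (transport_cost @` coupling mu nu) <= c%:E)%E.
  by apply: ge_ereal_inf; exists (transport_cost pi) => //; exists pi.
rewrite fineK// ge0_fin_numE ?inf_transport_cost_ge0//.
exact: le_lt_trans infc (ltry _).
Qed.

Lemma W2_sqr_eq mu nu pi (c : R) : coupling mu nu pi ->
  (transport_cost pi <= c%:E)%E ->
  (forall rho, coupling mu nu rho -> (c%:E <= transport_cost rho)%E) ->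
  W2 mu nu ^+ 2 = c.
Proof.
move=> cpi pic cle; rewrite W2_sqrE (_ : ereal_inf _ = c%:E)//.
apply/eqP; rewrite eq_le; apply/andP; split.
  by apply: ge_ereal_inf; exists (transport_cost pi) => //; exists pi.
by apply: le_ereal_inf_tmp => _ [rho crho <-]; exact: cle.
Qed.

Lemma second_moment_dirac a :
  (second_moment (\d_(a : T) : probability T R) < +oo)%E.
Proof.
rewrite /second_moment integral_dirac//; last first.
  by apply/measurable_EFinP; exact: measurable_enorm_sqr.
by rewrite diracT mul1e ltry.
Qed.

Definition diracP2 a : P2 R d := MkP2 (second_moment_dirac a).

Lemma integral_cst_prob (P : probability T R) (c : R) :
  (\int[P]_x c%:E)%E = c%:E.
Proof.
rewrite integral_cst// [X in (_ * X)%E](_ : _ = 1%E) ?mule1//.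
exact: probability_setT.
Qed.

(** A map with bounded displacement keeps second moments finite, since the squared norm of [f x] is
    at most twice that of [x] plus [2 * c]. *)
Lemma second_moment_distribution mu (f : {mfun T >-> T}) (c : R) :
  (forall x : T, enorm (f x - x : 'rV[R]_d) ^+ 2 <= c) ->
  (second_moment (distribution mu f : probability T R) < +oo)%E.
Proof.
move=> fc.
have msq : measurable_fun [set: T]
    (fun x : T => (enorm (x : 'rV[R]_d) ^+ 2)%:E).
  by apply/measurable_EFinP; exact: measurable_enorm_sqr.
have sq0 (x : T) : (0 <= (enorm (x : 'rV[R]_d) ^+ 2)%:E)%E.
  by rewrite lee_fin sqr_ge0.
have c0 : 0 <= c by apply: le_trans (fc 0); exact: sqr_ge0.
rewrite /second_moment ge0_integral_distribution//.
apply: (@le_lt_trans _ _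
    (\int[mu]_x (2%:E * (enorm (x : 'rV[R]_d) ^+ 2)%:E + (2 * c)%:E)))%E.
  apply: ge0_le_integral => //.
  - by move=> x _; exact: sq0.
  - exact: (measurableT_comp msq (measurable_funPT f)).
  - by apply: emeasurable_funD => //; exact: measurable_funeM.
  - move=> x _ /=; rewrite -EFinM -EFinD lee_fin.
    rewrite -[X in enorm X](subrK (x : 'rV[R]_d)).
    by apply: le_trans (enorm_sqrD_le _ _) _; rewrite addrC lerD2l ler_pM2l.
rewrite ge0_integralD//; last 3 first.
- by move=> x _; rewrite mule_ge0.
- exact: measurable_funeM.
- by move=> x _; rewrite lee_fin mulr_ge0.
rewrite ge0_integralZl//.
rewrite integral_cst_prob lte_add_pinfty ?ltry//.
by rewrite lte_mul_pinfty// ?lee_fin//; exact: P2_second_moment.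
Qed.

(* The interpolated plan [(1 - h) (id, f)_# mu + h \d_(a, b)]. *)
Lemma coupling_mix_exists (h : {i01 R}) mu (nu : probability T R)
    (f : {mfun T >-> T}) a b (c : R) :
  (forall A : set T, measurable A -> nu A = mu (f @^-1` A)) ->
  (forall x : T, enorm (x - f x : 'rV[R]_d) ^+ 2 <= c) ->
  exists2 pi, coupling (mixture_measure h mu (diracP2 a))
                       (mixture_measure h nu (diracP2 b)) pi &
    (transport_cost pi <=
       ((1 - h%:num) * c + h%:num * enorm (a - b) ^+ 2)%:E)%E.
Proof.
move=> nuf fc.
have mp : measurable_fun setT (fun x : T => (x, f x)).
  by apply: measurable_fun_pair => //; exact: measurable_funP.
pose p : {mfun T >-> (T * T)%type} := mfun_Sub (mem_set mp).
pose pi : probability (T * T)%type R :=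
  mix h (distribution mu p) (\d_((a, b) : T * T)).
exists pi => [A mA|].
  split; rewrite [RHS]mixture_measureE [LHS]mixE.
    congr (_ * _ + _ * _)%E.
      rewrite /distribution /pushforward; congr (P2_prob mu _).
      by apply/seteqP; split=> x //= [].
    by rewrite [LHS]diracE [RHS]diracE in_setX in_setT andbT.
  congr (_ * _ + _ * _)%E.
    rewrite nuf// /distribution /pushforward; congr (P2_prob mu _).
    by apply/seteqP; split=> x //= [].
  by rewrite [LHS]diracE [RHS]diracE in_setX in_setT.
rewrite /transport_cost ge0_integral_mix;
  [|exact: cost_ge0|exact: measurable_ecost].
rewrite ge0_integral_distribution; [|exact: measurable_ecost|exact: cost_ge0].
rewrite integral_dirac//; last exact: measurable_ecost.
rewrite [in leLHS]diracT mul1e [leRHS]EFinD !EFinM; apply: leeD => //.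
rewrite lee_wpmul2l ?lee_fin ?subr_ge0//.
rewrite -(integral_cst_prob mu c).
apply: ge0_le_integral => //.
- by move=> x _; exact: cost_ge0.
- exact: (measurableT_comp measurable_ecost mp).
- by move=> x _; rewrite lee_fin; exact: fc.
Qed.

(* Kantorovich duality with the potentials [u := c * (\1_a - \1_(S `\ a))] and
   [v := c * (\1_b - \1_(S `\ b))], [c] being half of [enorm (a - b) ^+ 2];
   the negative parts, which are null, are moved to the other side. *)
Lemma transport_cost_ge (h : {i01 R}) mu (S : set T) a b pi :
  measurable S -> mu S = 0%E -> S a -> S b ->
  (forall y : 'rV[R]_d, ~ S y ->
    enorm (a - b) ^+ 2 <= 2 * enorm (a - y) ^+ 2) ->
  (forall y : 'rV[R]_d, ~ S y ->
    enorm (a - b) ^+ 2 <= 2 * enorm (y - b) ^+ 2) ->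
  coupling (mixture_measure h mu (diracP2 a))
           (mixture_measure h mu (diracP2 b)) pi ->
  ((h%:num * enorm (a - b) ^+ 2)%:E <= transport_cost pi)%E.
Proof.
move=> mS S0 Sa Sb far_a far_b cpi.
set c := enorm (a - b) ^+ 2 / 2.
have c0 : 0 <= c by rewrite divr_ge0 ?sqr_ge0.
have null A : measurable A -> A `<=` S -> mu A = 0%E.
  by move=> mA AS; apply: (subset_measure0 mA mS AS S0).
have ma := measurable_point a; have mb := measurable_point b.
have mSa : measurable (S `\` [set (a : T)]) by exact: measurableD.
have mSb : measurable (S `\` [set (b : T)]) by exact: measurableD.
(* As [mu] does not charge [S], each marginal gives its atom mass exactly [h] and the rest of [S]
   mass zero ([Na]). *)
have Ma e (me : measurable [set (e : T)]) : S e ->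
    mixture_measure h mu (diracP2 e) [set e] = h%:num%:E.
  move=> Se; rewrite [LHS]mixture_measureE null//; last by move=> _ ->.
  by rewrite mule0 add0e [X in (_ * X)%E]diracE mem_set// mule1.
have Na e (me : measurable (S `\` [set (e : T)])) :
    mixture_measure h mu (diracP2 e) (S `\` [set e]) = 0%E.
  rewrite [LHS]mixture_measureE (null _ me) ?mule0 ?add0e; last by move=> x [].
  rewrite [X in (_ * X)%E]diracE memNset ?mule0//.
  by case=> _; exact.
pose I (A : set (T * T)) z : \bar R := (c * \1_A z)%:E.
have I0 A z : (0 <= I A z)%E by rewrite lee_fin mulr_ge0.
have mI A : measurable A -> measurable_fun setT (I A).
  by move=> mA; apply/measurable_EFinP; apply: measurable_funM => //.
have intI A : measurable A -> (\int[pi]_z I A z = c%:E * pi A)%E.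
  move=> mA; rewrite /I; under eq_integral do rewrite EFinM.
  rewrite ge0_integralZl//.
  - by rewrite integral_indic// setIT.
  - by apply/measurable_EFinP.
have mX1 (A : set T) : measurable A -> measurable (A `*` [set: T]).
  by move=> mA; exact: measurableX.
have mX2 (A : set T) : measurable A -> measurable ([set: T] `*` A).
  by move=> mA; exact: measurableX.
have H : (\int[pi]_z (I ([set (a : T)] `*` setT) z
                   + I (setT `*` [set (b : T)]) z)
    <= \int[pi]_z ((cost z)%:E + (I ((S `\` [set (a : T)]) `*` setT) z
                   + I (setT `*` (S `\` [set (b : T)])) z)))%E.
  apply: ge0_le_integral => //.
  - by move=> z _; rewrite adde_ge0.
  - by apply: emeasurable_funD; apply: mI; auto.
  - apply: emeasurable_funD; first exact: measurable_ecost.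
    by apply: emeasurable_funD; apply: mI; auto.
  - move=> [x y] _; rewrite /I -!EFinD lee_fin /cost /= !indicE !in_setX.
    rewrite !in_setT !andbT /= !in_setD.
    rewrite (_ : (x \in [set (a : T)]) = (x == a));
      last by apply/idP/eqP; rewrite in_setE.
    rewrite (_ : (y \in [set (b : T)]) = (y == b));
      last by apply/idP/eqP; rewrite in_setE.
    have fa : y \notin S -> c <= enorm (a - y) ^+ 2.
      by rewrite notin_setE => /far_a; rewrite /c; lra.
    have fb : x \notin S -> c <= enorm (x - b) ^+ 2.
      by rewrite notin_setE => /far_b; rewrite /c; lra.
    have := sqr_ge0 (enorm (x - y : 'rV[R]_d)).
    (* Equality holds at [(a, b)]. If only one coordinate sits at its atom, the other lies either in
       [S], where the added term supplies [c], or off [S], where the cost is at least [c]. *)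
    have [xa|xa] := eqVneq x a; have [yb|yb] := eqVneq y b => /=.
    - by rewrite xa yb !andbF /= /c; lra.
    - by rewrite xa andbF andbT; have [yS|/fa] := boolP (y \in S) => /=; lra.
    - by rewrite yb andbF andbT; have [xS|/fb] := boolP (x \in S) => /=; lra.
    - by case: (x \in S); case: (y \in S) => /=; lra.
move: H; rewrite !ge0_integralD//; try by
  [apply: mI; auto|apply: measurable_ecost|move=> z _; rewrite adde_ge0
  |move=> z _; exact: cost_ge0|apply: emeasurable_funD; apply: mI; auto].
rewrite !intI; try by auto.
rewrite (etrans (cpi _ ma).1 (Ma _ ma Sa)) (etrans (cpi _ mb).2 (Ma _ mb Sb)).
rewrite (etrans (cpi _ mSa).1 (Na _ mSa)) (etrans (cpi _ mSb).2 (Na _ mSb)).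
rewrite !mule0 !adde0 -!EFinM -EFinD; apply: le_trans.
by rewrite lee_fin /c; lra.
Qed.

Lemma clamp01_id (h : R) : 0 <= h <= 1 -> Num.max 0 (Num.min h 1) = h.
Proof. by move=> /andP[h0 h1]; rewrite min_l// max_r. Qed.

(** The plan that fixes [mu] and moves only the atom is optimal: replacing the move from [a] to [b]
    by one through a point [y] off [S] costs at least half of [enorm (a - b) ^+ 2] for each leg, so
    nothing is gained. *)
Lemma W2_sqr_move (h : R) mu (S : set T) a b : 0 <= h <= 1 ->
  measurable S -> mu S = 0%E -> S a -> S b ->
  (forall y : 'rV[R]_d, ~ S y ->
    enorm (a - b) ^+ 2 <= 2 * enorm (a - y) ^+ 2) ->
  (forall y : 'rV[R]_d, ~ S y ->
    enorm (a - b) ^+ 2 <= 2 * enorm (y - b) ^+ 2) ->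
  W2 (mixture h mu (diracP2 a)) (mixture h mu (diracP2 b)) ^+ 2 =
  h * enorm (a - b) ^+ 2.
Proof.
move=> h01 mS S0 Sa Sb fa fb.
(* This is the weight that [mixture] builds from [h], so [mixture h] unfolds to
   [mixture_measure k]. *)
pose k : {i01 R} := Itv01 (clamp01_ge0 h) (clamp01_le1 h).
have kE : k%:num = h by exact: clamp01_id.
pose f : {mfun T >-> T} := mfun_Sub (mem_set (@measurable_id _ T setT)).
have [|x|pi cpi pic] := @coupling_mix_exists k mu mu f a b 0.
- by [].
- by rewrite subrr enorm_sqrE big1// => i _; rewrite mxE expr0n.
apply: (W2_sqr_eq (mu := mixture h mu _) (nu := mixture h mu _) cpi).
  by move: pic; rewrite kE mulr0 add0r.
by move=> rho crho; rewrite -kE; exact: (transport_cost_ge mS S0 Sa Sb).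
Qed.

(** The atom stays fixed and the rest, of mass [1 - h], follows [f], at cost at most
    [(1 - h) * c]. *)
Lemma W2_sqr_perturb (h : R) mu nu (f : {mfun T >-> T}) a (c : R) :
  0 <= h <= 1 ->
  (forall A : set T, measurable A -> nu A = mu (f @^-1` A)) ->
  (forall x : T, enorm (x - f x : 'rV[R]_d) ^+ 2 <= c) ->
  W2 (mixture h mu (diracP2 a)) (mixture h nu (diracP2 a)) ^+ 2 <= c.
Proof.
move=> h01 nuf fc.
pose k : {i01 R} := Itv01 (clamp01_ge0 h) (clamp01_le1 h).
have kE : k%:num = h by exact: clamp01_id.
have [pi cpi pic] := @coupling_mix_exists k mu nu f a a c nuf fc.
apply: (W2_sqr_le (mu := mixture h mu _) (nu := mixture h nu _) cpi).
apply: (le_trans pic); rewrite kE lee_fin.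
have -> : enorm (a - a) ^+ 2 = 0.
  by rewrite subrr enorm_sqrE big1// => i _; rewrite mxE expr0n.
rewrite mulr0 addr0 ler_piMl//; first by apply: le_trans (fc 0); exact: sqr_ge0.
by case/andP: h01 => h0 h1; rewrite gerBl.
Qed.

(** * Pushing a measure off a slab *)

Lemma measurable_dotp (a v : 'rV[R]_d) :
  measurable_fun [set: T] (fun x : T => dotp ((x : 'rV[R]_d) - a) v).
Proof.
rewrite (_ : (fun x : T => _) =
    fun x : T => \sum_(i < d) ((x : 'rV[R]_d) 0 i - a 0 i) * v 0 i).
  apply: measurable_sum => i; apply: measurable_funM => //.
  by apply: measurable_funB => //; exact: measurable_coord.
by apply/funext => x; apply: eq_bigr => i _; rewrite !mxE.
Qed.

(** For [v] nonzero, the open neighborhood of half-width [e * enorm v] of the hyperplane through [a]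
    orthogonal to [v]. It contains every line through [a] orthogonal to [v] when [e] is positive. *)
Definition slab (a v : 'rV[R]_d) (e : R) : set T :=
  [set x : T | `|dotp ((x : 'rV[R]_d) - a) v| < e * enorm v ^+ 2].

Lemma measurable_slab a v (e : R) : measurable (slab a v e).
Proof.
rewrite /slab -[X in measurable X]setTI; apply: measurable_fun_ltr => //.
by apply: measurableT_comp => //; exact: measurable_dotp.
Qed.

Section away_from_slab.
Variables (a v : 'rV[R]_d) (e : R).
Hypothesis e0 : 0 <= e.

(** Each point moves by [e *: v] away from the hyperplane, on its own side, so the absolute value of
    the inner product grows by exactly [e * enorm v ^+ 2] and every point leaves the slab. *)
Definition away (x : T) : T :=
  if 0 <= dotp ((x : 'rV[R]_d) - a) v then (x : 'rV[R]_d) + e *: v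
  else (x : 'rV[R]_d) - e *: v.

Lemma measurable_away : measurable_fun [set: T] away.
Proof.
apply: measurable_fun_ifT.
- by apply: measurable_fun_ler => //; exact: measurable_dotp.
- apply: (@continuous_measurable_rV (fun x => x + e *: v)) => x.
  exact: (cvgD cvg_id (cvg_cst _)).
- apply: (@continuous_measurable_rV (fun x => x - e *: v)) => x.
  exact: (cvgB cvg_id (cvg_cst _)).
Qed.

Definition away_mfun : {mfun T >-> T} := mfun_Sub (mem_set measurable_away).

Lemma away_notin_slab x : ~ slab a v e (away x).
Proof.
have N0 : 0 <= e * enorm v ^+ 2 by rewrite mulr_ge0 ?sqr_ge0.
apply/negP; rewrite -leNgt /away; case: ifPn => [xa|].
  rewrite addrAC dotpDl dotpZl dotpp ger0_norm ?addr_ge0//.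
  by rewrite lerDr.
rewrite -ltNge => xa; rewrite addrAC dotpDl dotpNl dotpZl dotpp ltr0_norm; lra.
Qed.

Lemma away_dist (x : T) :
  enorm (away x - x : 'rV[R]_d) ^+ 2 = e ^+ 2 * enorm v ^+ 2.
Proof.
rewrite /away; case: ifP => _; rewrite addrAC subrr add0r ?enorm_sqrZ//.
by rewrite -scaleNr enorm_sqrZ sqrrN.
Qed.

Lemma second_moment_away mu :
  (second_moment (distribution mu away_mfun : probability T R) < +oo)%E.
Proof.
apply: (@second_moment_distribution _ _ (e ^+ 2 * enorm v ^+ 2)) => x.
by rewrite -(away_dist x).
Qed.

Definition awayP2 mu : P2 R d := MkP2 (second_moment_away mu).

Lemma awayP2_slab mu : awayP2 mu (slab a v e) = 0%E.
Proof.
rewrite /awayP2 /= /distribution /pushforward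
  (_ : _ @^-1` _ = set0) ?measure0//.
by apply/seteqP; split => x //= /away_notin_slab.
Qed.

Lemma W2_sqr_away (h : R) mu b : 0 <= h <= 1 ->
  W2 (mixture h mu (diracP2 b)) (mixture h (awayP2 mu) (diracP2 b)) ^+ 2
    <= e ^+ 2 * enorm v ^+ 2.
Proof.
move=> h01; apply: (@W2_sqr_perturb _ _ _ away_mfun) => // x.
by rewrite enorm_distC -(away_dist x).
Qed.

End away_from_slab.


(** * Semiconvexity of [F] along a moving atom *)

Variables (Lambda : R) (F : P2 R d -> R).
Hypothesis F_conv : geodesically_convex Lambda F.

Definition segment (y0 y1 : 'rV[R]_d) (t : R) := (1 - t) *: y0 + t *: y1.

Definition atom_path h mu (y0 y1 : 'rV[R]_d) (t : R) : P2 R d :=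
  mixture h mu (diracP2 (segment y0 y1 t)).

Lemma moving_atom_semiconvex_slab (h e t : R) mu (y0 y1 v : 'rV[R]_d) :
  0 <= h <= 1 -> 0 < e -> 0 < enorm v ^+ 2 -> dotp (y1 - y0) v = 0 ->
  mu (slab y0 v e) = 0%E -> 0 <= t <= 1 ->
  F (atom_path h mu y0 y1 t) <=
    (1 - t) * F (atom_path h mu y0 y1 0) + t * F (atom_path h mu y0 y1 1)
             - Lambda / 2 * h * enorm (y1 - y0) ^+ 2 * t * (1 - t).
Proof.
move=> h01 e0 v0 y01v mu0 t01; pose M := atom_path h mu y0 y1.
set D := enorm (y1 - y0) ^+ 2; have D0 : 0 <= D by exact: sqr_ge0.
have D1 : 0 < 1 + D by lra.
set N := enorm v ^+ 2 in v0.
have eN : 0 < e * N by exact: mulr_gt0.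
have e2N : 0 < e ^+ 2 * N / (1 + D) by rewrite divr_gt0// mulr_gt0// exprn_gt0.
(* A parameter change of at most [l] moves the atom by at most the half-width of the slab; [1 + D]
   covers the case [y0 = y1]. *)
pose l := Num.sqrt (e ^+ 2 * N / (1 + D)).
have l0 : 0 < l by rewrite sqrtr_gt0.
have l2 : l ^+ 2 * D <= e ^+ 2 * N.
  rewrite sqr_sqrtr ?(ltW e2N)// mulrAC ler_pdivrMr//.
  by have := mulr_gt0 (exprn_gt0 2 e0) v0; lra.
have MW s u : `|s - u| <= l -> W2 (M s) (M u) ^+ 2 = h * ((s - u) ^+ 2 * D).
  move=> sul.
  have suD : (s - u) ^+ 2 * D <= e ^+ 2 * N.
    apply: le_trans l2; rewrite ler_wpM2r// -real_normK ?num_real//.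
    by rewrite ler_sqr ?nnegrE// ltW.
  have onslab w : dotp (segment y0 y1 w - y0) v = 0.
    rewrite (_ : _ - y0 = w *: (y1 - y0)) ?dotpZl ?y01v ?mulr0//.
    by apply/rowP => i; rewrite !mxE; ring.
  (* Points off the slab are at least its half-width away from the whole line, hence at least as far
     as a short move reaches. *)
  have far w (y : 'rV[R]_d) : ~ slab y0 v e y ->
      e ^+ 2 * N <= enorm (segment y0 y1 w - y) ^+ 2.
    move=> /negP; rewrite -leNgt => ye.
    apply: enorm_sqr_ge_slab; first exact: ltW.
    rewrite (_ : _ - y = (segment y0 y1 w - y0) - (y - y0)); last first.
      by rewrite opprB addrA subrK.
    by rewrite dotpDl onslab add0r dotpNl normrN.
  rewrite -enorm_sqrZ -segment_sub.
  apply: (@W2_sqr_move _ _ (slab y0 v e)) => //.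
  - exact: measurable_slab.
  - by rewrite /slab /= onslab normr0.
  - by rewrite /slab /= onslab normr0.
  - move=> y /far -/(_ s) ys.
    have := sqr_ge0 (enorm (segment y0 y1 s - y)).
    by rewrite segment_sub enorm_sqrZ -/D; lra.
  - move=> y /far -/(_ u) ys; rewrite enorm_distC in ys.
    have := sqr_ge0 (enorm (y - segment y0 y1 u)).
    by rewrite segment_sub enorm_sqrZ -/D; lra.
have := @locally_semiconvex _ (F \o M) (Lambda / 2 * h * D) l l0 _ t t01.
apply => p r s p0 pr r1 rpl s01 /=.
(* The piece from [p] to [r], rescaled to [[0, 1]]; by [MW] it has constant speed. *)
pose gamma u := M ((1 - u) * p + u * r).
have gW u w : 0 <= u <= 1 -> 0 <= w <= 1 ->
    W2 (gamma u) (gamma w) ^+ 2 = h * (((u - w) * (r - p)) ^+ 2 * D).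
  move=> /andP[u0 u1] /andP[w0 w1].
  have E : (1 - u) * p + u * r - ((1 - w) * p + w * r) = (u - w) * (r - p).
    by ring.
  rewrite /gamma MW E// normrM (ger0_norm (_ : 0 <= r - p)) ?subr_ge0//.
  apply: le_trans rpl; rewrite ler_piMl ?subr_ge0// ler_norml; lra.
have g : W2_geodesic (gamma 0) (gamma 1) gamma.
  split=> // u w u01 w01.
  apply/eqP; rewrite -(@eqrXn2 _ 2)//; last 2 first.
  - exact: sqrtr_ge0.
  - by rewrite mulr_ge0// sqrtr_ge0.
  rewrite exprMn !gW// ?lexx ?ler01// real_normK ?num_real//.
  by apply/eqP; ring.
have := F_conv g s01; rewrite gW ?lexx ?ler01//.
rewrite /gamma !subr0 !mul1r !mul0r !addr0 subrr mul0r add0r => K.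
by apply: (le_trans K); rewrite le_eqVlt; apply/orP; left; apply/eqP; ring.
Qed.

Hypothesis F_cont : W2_continuous F.

Lemma moving_atom_semiconvex (h t : R) mu (y0 y1 : 'rV[R]_d) : (2 <= d)%N ->
  0 <= h <= 1 -> 0 <= t <= 1 ->
  F (atom_path h mu y0 y1 t) <=
    (1 - t) * F (atom_path h mu y0 y1 0) + t * F (atom_path h mu y0 y1 1)
             - Lambda / 2 * h * enorm (y1 - y0) ^+ 2 * t * (1 - t).
Proof.
move=> d2 h01 t01; pose M := atom_path h mu y0 y1.
have [v v0 y01v] := orthogonal_exists (y1 - y0) d2.
(* Each of the three values of [F] may change by [eta / 2]; the weights [1 - t] and [t] sum to 1, so
   the total error is at most [eta]. *)
apply/ler_addgt0Pr => eta eta0.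
have eta2 : 0 < eta / 2 by rewrite divr_gt0.
have [dt dt0 Ht] := F_cont (M t) eta2.
have [d0 d00 H0] := F_cont (M 0) eta2.
have [d1 d10 H1] := F_cont (M 1) eta2.
pose delta := Num.min dt (Num.min d0 d1).
have delta0 : 0 < delta by rewrite !lt_min dt0 d00.
have v1 : 0 < 1 + enorm v by rewrite ltr_pwDl// sqrtr_ge0.
(* This makes the displacement [e * enorm v] strictly smaller than [delta]. *)
pose e := delta / (1 + enorm v).
have e0 : 0 < e by rewrite divr_gt0.
pose M' := atom_path h (awayP2 y0 v e mu) y0 y1.
have W s : W2 (M s) (M' s) < delta.
  apply: (@le_lt_trans _ _ (e * enorm v)).
    have ev0 : 0 <= e * enorm v.
      by apply: mulr_ge0; [exact: ltW|exact: sqrtr_ge0].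
    rewrite -ler_sqr ?nnegrE ?sqrtr_ge0// exprMn.
    by apply: W2_sqr_away => //; exact: ltW.
  by rewrite /e mulrAC ltr_pdivrMr// ltr_pM2l// ltrDr.
have := W t; rewrite /delta !lt_min => /andP[/Ht Kt _].
have := W 0; rewrite /delta !lt_min => /and3P[_ /H0 K0 _].
have := W 1; rewrite /delta !lt_min => /and3P[_ _ /H1 K1].
have mu0 : awayP2 y0 v e mu (slab y0 v e) = 0%E.
  by apply: awayP2_slab; exact: ltW.
have := moving_atom_semiconvex_slab h01 e0 v0 y01v mu0 t01.
rewrite -/M' => K.
move: Kt K0 K1; rewrite !ltr_norml => /andP[Kt _] /andP[_ K0] /andP[_ K1].
have /andP[t0 t1] := t01.
have : (1 - t) * (F (M' 0) - F (M 0)) <= (1 - t) * (eta / 2).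
  by rewrite ler_wpM2l ?subr_ge0// ltW.
have : t * (F (M' 1) - F (M 1)) <= t * (eta / 2).
  by rewrite ler_wpM2l// ltW.
lra.
Qed.

End wasserstein.

(** * Passage to the limit in the difference quotients *)

Theorem corollary4p11 (R : realType) (d : nat) (hd : (2 <= d)%N)
    (Lambda : R) (F : P2 R d -> R)
    (F_cont : W2_continuous F)
    (F_conv : geodesically_convex Lambda F)
    (mu : P2 R d) (Df : 'rV[R]_d -> R)
    (F_flat : is_flat_derivative F mu Df) :
  lambda_convex Lambda Df.
Proof.
move: F_flat => [mDf _ lim norm] y0 y1 t t01.
pose q y h := (F (mixture h mu (diracP2 y)) - F mu) / h.
(* Flat differentiability is tested against the Dirac mass at [y]; normalization removes the
   integral over [mu]. *)
have qlim y : q y h @[h --> 0^'+] --> Df y.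
  have := lim (diracP2 y); rewrite norm subr0 /Rintegral integral_dirac//.
    by rewrite diracT mul1e.
  by apply/measurable_EFinP.
(* The weights sum to 1, so [F mu] can be subtracted throughout; the convexity term is proportional
   to [h], so division by [h] leaves it independent of [h]. *)
have qconv (h : R) : 0 < h -> h <= 1 -> q (segment y0 y1 t) h <=
    (1 - t) * q y0 h + t * q y1 h
    - Lambda / 2 * t * (1 - t) * enorm (y0 - y1) ^+ 2.
  move=> h0 h1; have h01 : 0 <= h <= 1 by rewrite (ltW h0).
  have := moving_atom_semiconvex F_conv F_cont mu y0 y1 hd h01 t01.
  rewrite /atom_path.
  have -> : segment y0 y1 0 = y0.
    by rewrite /segment subr0 scale1r scale0r addr0.
  have -> : segment y0 y1 1 = y1.
    by rewrite /segment subrr scale1r scale0r add0r.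
  rewrite /q ler_pdivrMr// enorm_distC => K.
  rewrite [leRHS](_ : _ = (1 - t) * F (mixture h mu (diracP2 y0)) +
      t * F (mixture h mu (diracP2 y1)) - F mu
      - Lambda / 2 * h * enorm (y0 - y1) ^+ 2 * t * (1 - t)).
    by lra.
  by field; rewrite gt_eqF.
apply: (@ler_cvg_to _ (0^'+) _ R (q (segment y0 y1 t))
  (fun h => (1 - t) * q y0 h + t * q y1 h
            - Lambda / 2 * t * (1 - t) * enorm (y0 - y1) ^+ 2)).
- exact: qlim.
- apply: cvgB; last exact: cvg_cst.
  by apply: cvgD; (apply: cvgM; first exact: cvg_cst); exact: qlim.
near=> h; apply: qconv; near: h.
  exact: nbhs_right_gt.
exact: nbhs_right_le.
Unshelve. all: by end_near.
Qed.
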